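(* Let $K$ be a field and let $M\in M_{n,n}(K)$. There exists a regular matrix ${}^dM\in M_{n,n}(K)$ such that $({}^dM)^s$ is similar to $M$.
   Context: For $N\in M_{n,n}(K)$ with entries $N_{i,j}$, the sequential mapping $N^\downarrow:K^n\to K^n$ sends $X=(x_1,\dots,x_n)$ to the vector obtained by executing in place on $X$ the program ''for $i$ from $1$ to $n$ do $x_i:=\sum_{j=1}^n N_{i,j}x_j$'' (each assignment uses the current values of the components, some of which have already been overwritten). This map is linear, and $N^s\in M_{n,n}(K)$ denotes the matrix representing it, i.e. $N^s X=N^\downarrow(X)$ for all $X\in K^n$. A matrix is regular if all its diagonal entries equal $1$. A matrix $M'$ is similar to $M$ if $M'_{i,j}=M_{i,j}$ for all $i\neq j$ (they may differ only on the diagonal). *)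

(* Defs.v *)
From mathcomp Require Import all_boot all_algebra.

Set Implicit Arguments.
Unset Strict Implicit.
Unset Printing Implicit Defensive.

Import GRing.Theory.
Local Open Scope ring_scope.

Definition assign (K : fieldType) (n : nat) (N : 'M[K]_n) (X : 'cV[K]_n)
    (i : 'I_n) : 'cV[K]_n :=
  \col_k (if k == i then \sum_(j < n) N i j * X j 0 else X k 0).

(* [enum 'I_n] lists the indices in increasing order (see [val_enum_ord]). *)
Definition seqmap (K : fieldType) (n : nat) (N : 'M[K]_n) (X : 'cV[K]_n) :
    'cV[K]_n :=
  foldl (assign N) X (enum 'I_n).

(* The j-th column is the image of the j-th canonical basis vector; [seqmxE]
   below shows that this matrix represents [seqmap N]. *)
Definition seqmx (K : fieldType) (n : nat) (N : 'M[K]_n) : 'M[K]_n :=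
  \matrix_(i, j) seqmap N (delta_mx j 0) i 0.

Definition regular_mx (K : fieldType) (n : nat) (N : 'M[K]_n) : Prop :=
  forall i : 'I_n, N i i = 1.

(* Not conjugacy: equality of all the off-diagonal entries. *)
Definition similar_offdiag (K : fieldType) (n : nat) (M' M : 'M[K]_n) : Prop :=
  forall i j : 'I_n, i != j -> M' i j = M i j.

Lemma assign_is_linear (K : fieldType) (n : nat) (N : 'M[K]_n) (i : 'I_n) :
  linear (fun X => assign N X i).
Proof.
move=> a X Y; apply/colP=> k; rewrite !mxE; case: eqP => // _.
rewrite mulr_sumr -big_split /=; apply: eq_bigr => j _.
by rewrite !mxE mulrDr mulrCA.
Qed.

Lemma seqmap_is_linear (K : fieldType) (n : nat) (N : 'M[K]_n) :
  linear (seqmap N).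
Proof.
rewrite /seqmap; elim: (enum 'I_n) => [|i s IHs] a X Y //=.
by rewrite assign_is_linear IHs.
Qed.

Lemma seqmxE (K : fieldType) (n : nat) (N : 'M[K]_n) (X : 'cV[K]_n) :
  seqmx N *m X = seqmap N X.
Proof.
have lin := @seqmap_is_linear K n N.
have map0 : seqmap N 0 = 0.
  by have := lin (-1) 0 0; rewrite scaler0 addr0 scaleN1r addNr.
have sum s : seqmap N (\sum_(j <- s) X j 0 *: delta_mx j 0)
           = \sum_(j <- s) X j 0 *: seqmap N (delta_mx j 0).
  by elim: s => [|j s IHs]; rewrite ?big_nil // !big_cons lin IHs.
have {2}-> : X = \sum_j X j 0 *: delta_mx j 0.
  by rewrite [LHS]matrix_sum_delta; apply: eq_bigr => j _; rewrite big_ord1.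
rewrite sum; apply/colP=> i; rewrite !mxE summxE.
by apply: eq_bigr => j _; rewrite !mxE mulrC.
Qed.

(* Main.v *)
(** Write [N = L + 1 + U] with [L], [U] strictly lower and upper triangular.
    The sequential map satisfies [Y = L Y + (1 + U) X], so [N^s] is the [S] with
    [(1 - L) S = 1 + U].  One therefore adjusts the diagonal of [M] into a matrix
    [S] that Gaussian elimination without pivoting, with all pivots [1], turns
    into a unit upper triangular matrix [A S], and takes [L = 1 - A],
    [U = A S - 1]. *)
Require Import Defs.
From mathcomp Require Import all_boot all_algebra.

Set Implicit Arguments.
Unset Strict Implicit.
Unset Printing Implicit Defensive.

Import GRing.Theory.
Local Open Scope ring_scope.

(** After the first [m] assignments the state agrees with [Y] below index [m] and still with [X]
    from [m] on, so the next assignment reads exactly the mixed vector of the hypothesis. *)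
Lemma seqmap_unique (K : fieldType) (n : nat) (N : 'M[K]_n) (X Y : 'cV[K]_n) :
  (forall i : 'I_n,
     Y i 0 = \sum_(j < n) N i j * (if (j < i)%N then Y j 0 else X j 0)) ->
  seqmap N X = Y.
Proof.
move=> eqY.
suff prefix m : (m <= n)%N -> foldl (assign N) X (take m (enum 'I_n))
                  = \col_k (if (k < m)%N then Y k 0 else X k 0).
  have := prefix n (leqnn n); rewrite take_oversize ?size_enum_ord // => eq_n.
  by rewrite [LHS]eq_n; apply/colP=> k; rewrite mxE ltn_ord.
elim: m => [|m IHm] lt_mn; first by rewrite take0; apply/colP=> k; rewrite mxE.
pose i := Ordinal lt_mn.
rewrite (take_nth i) ?size_enum_ord // foldl_rcons IHm 1?ltnW //.
rewrite (nth_ord_enum i i); apply/colP=> k; rewrite !mxE.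
case: (eqVneq k i) => [->|neq_ki].
  by rewrite leqnn eqY; apply: eq_bigr => j _; rewrite mxE.
rewrite ltnS [in RHS]leq_eqVlt.
by have /negPf-> : (k : nat) != m by apply: contraNneq neq_ki => eq_km; apply/eqP/val_inj.
Qed.

Lemma unit_triangular_elimination (K : fieldType) (n : nat) (M : 'M[K]_n) :
  exists A S : 'M[K]_n,
    [/\ is_trig_mx A, is_trig_mx (A *m S)^T, forall i, A i i = 1,
        forall i, (A *m S) i i = 1 & similar_offdiag S M].
Proof.
elim: n M => [|n IHn].
  by move=> M; exists 0, 0; split; try (by case); apply/is_trig_mxP; case.
rewrite -[n.+1]/(1 + n)%N => M; pose r := ursubmx M; pose c := dlsubmx M.
(* With pivot [1], eliminating the first column leaves the Schur complement [drsubmx M - c *m r]. *)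
have [A [T [trigA trigAT A1 AT1 simT]]] := IHn (drsubmx M - c *m r).
pose A' : 'M_(1 + n) := block_mx 1%:M 0 (- (A *m c)) A.
(* The corner can be set to [1] because the diagonal is free. Adding [c *m r] back makes [T] the
   Schur complement of [S'] and restores the off-diagonal entries of [M]. *)
pose S' : 'M_(1 + n) := block_mx 1%:M r c (T + c *m r).
have AS : A' *m S' = block_mx 1%:M r 0 (A *m T).
  rewrite mulmx_block !mul1mx !mul0mx !addr0 mulmx1 addNr mulNmx mulmxDr mulmxA.
  by rewrite addrCA addNr addr0.
exists A', S'; rewrite AS; split.
- by rewrite is_trig_block_mx // eqxx scalar_mx_is_trig trigA.
- by rewrite tr_block_mx trmx0 trmx1 is_trig_block_mx // eqxx scalar_mx_is_trig trigAT.
- move=> i; case: (split_ordP i) => k ->; rewrite ?block_mxEul ?block_mxEdr //.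
  by rewrite mxE eqxx.
- move=> i; case: (split_ordP i) => k ->; rewrite ?block_mxEul ?block_mxEdr //.
  by rewrite mxE eqxx.
move=> i j; rewrite -[M in RHS]submxK.
case: (split_ordP i) => k ->; case: (split_ordP j) => l -> neq_ij.
- by rewrite !ord1 eqxx in neq_ij.
- by rewrite !block_mxEur.
- by rewrite !block_mxEdl.
have neq_kl : k != l by apply: contraNneq neq_ij => ->.
by rewrite !block_mxEdr mxE simT // !mxE subrK.
Qed.

Theorem theorem2 (K : fieldType) (n : nat) (M : 'M[K]_n) :
  exists dM : 'M[K]_n, regular_mx dM /\ similar_offdiag (seqmx dM) M.
Proof.
have [A [S [/is_trig_mxP trigA /is_trig_mxP trigAS A1 AS1 simS]]] :=
  unit_triangular_elimination M.
pose dM : 'M_n := \matrix_(i, j) (if (j < i)%N then - A i j else (A *m S) i j).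
exists dM; split=> [i|]; first by rewrite mxE ltnn AS1.
suff -> : seqmx dM = S by [].
apply/matrixP=> i j; rewrite mxE; set X := delta_mx j 0.
have -> : seqmap dM X = S *m X; last by rewrite -colE mxE.
apply: seqmap_unique => {}i; set Y := S *m X.
have eqAY : \sum_k A i k * Y k 0 = \sum_k (A *m S) i k * X k 0.
  by have /matrixP/(_ i 0) := mulmxA A S X; rewrite !mxE.
have {1}-> : Y i 0 = \sum_k (1%:M : 'M_n) i k * Y k 0.
  by have /matrixP/(_ i 0) := mul1mx Y; rewrite mxE.
(* Once [A Y = (A S) X] is added crosswise, the two sides agree term by term: both triangularity
   conditions settle [k != i], and the unit diagonals settle [k = i]. *)
apply: (addIr (\sum_k (A *m S) i k * X k 0)).
rewrite -{2}eqAY -!big_split; apply: eq_bigr => k _ /=.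
move: Y eqAY => Y _; rewrite [1%:M i k]mxE [dM i k]mxE -val_eqE /=.
case: (ltngtP k i) => [lt_ki|lt_ik|/val_inj->].
- have := trigAS k i lt_ki; rewrite mxE => ->.
  by rewrite !mul0r add0r mulNr addNr.
- by rewrite trigA // !mul0r add0r addr0.
by rewrite A1 AS1 !mul1r addrC.
Qed.
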